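(* Let $E$ and $\mathbf{H}$ be nonempty sets, let $\tau$ be a compact Hausdorff topology on $\mathbf{H}$, let $\mathbf{h}:E\to\mathbf{H}$ be a map, and let $\mathcal{A}$ be an algebra of subsets of $E$. Suppose that every $z\in\mathbf{H}$ has a local base $\mathcal{Z}$ of neighborhoods in $(\mathbf{H},\tau)$ such that $\mathbf{h}^{-1}(B)\in\mathcal{A}$ for all $B\in\mathcal{Z}$. Then for every nonempty family $\mathcal{E}\subset\mathcal{A}$, $$(\mathbf{as})[E;\mathbf{H};\tau;\mathbf{h};\mathcal{E}]=\{\mathfrak{H}_{\mathcal{A}}[\tau](\mathcal{U}):\ \mathcal{U}\in\mathbb{F}_o^*(\mathcal{A}\,|\,\mathcal{E})\}.$$
   Context: Neighborhoods: $N_\tau(z)$ is the family of all subsets of $\mathbf{H}$ that contain a $\tau$-open set containing $z$. A local base at $z$ is a family $\mathcal{Z}\subset N_\tau(z)$ such that every $S\in N_\tau(z)$ contains some $B\in\mathcal{Z}$ (members of $\mathcal{Z}$ need not be open). Filters of $\mathcal{A}$: a filter of $\mathcal{A}$ is a nonempty family $\mathcal{F}\subset\mathcal{A}$ with $\emptyset\notin\mathcal{F}$, closed under pairwise intersections, and such that $F\in\mathcal{F}$, $L\in\mathcal{A}$, $F\subset L$ imply $L\in\mathcal{F}$. $\mathbb{F}_o^*(\mathcal{A})$ is the set of ultrafilters of $\mathcal{A}$, i.e. filters of $\mathcal{A}$ maximal under inclusion, and $\mathbb{F}_o^*(\mathcal{A}\,|\,\mathcal{E})=\{\mathcal{U}\in\mathbb{F}_o^*(\mathcal{A}):\mathcal{E}\subset\mathcal{U}\}$.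 Convergence of filter bases: a filter base on $\mathbf{H}$ is a nonempty family $\mathcal{B}$ of nonempty subsets of $\mathbf{H}$ such that any $B_1\cap B_2$ ($B_1,B_2\in\mathcal{B}$) contains some $B_3\in\mathcal{B}$. $\mathcal{B}\stackrel{\tau}{\Longrightarrow}z$ means that every $S\in N_\tau(z)$ contains some member of $\mathcal{B}$. For a family $\mathcal{F}$ of subsets of $E$, $\mathbf{h}^1[\mathcal{F}]=\{\mathbf{h}(F):F\in\mathcal{F}\}$, where $\mathbf{h}(F)$ is the image of $F$. The map $\mathfrak{H}_{\mathcal{A}}[\tau]:\mathbb{F}_o^*(\mathcal{A})\to\mathbf{H}$: when $E$ and $\mathbf{H}$ are nonempty sets, $\tau$ is a compact Hausdorff topology on $\mathbf{H}$, $\mathbf{h}:E\to\mathbf{H}$ is a map, $\mathcal{A}$ is an algebra of subsets of $E$, and every $z\in\mathbf{H}$ has a local base $\mathcal{Z}$ of neighborhoods in $(\mathbf{H},\tau)$ such that $\mathbf{h}^{-1}(B)\in\mathcal{A}$ for all $B\in\mathcal{Z}$, then for each $\mathcal{U}\in\mathbb{F}_o^*(\mathcal{A})$ there is exactly one $z\in\mathbf{H}$ with $\mathbf{h}^1[\mathcal{U}]\stackrel{\tau}{\Longrightarrow}z$; $\mathfrak{H}_{\mathcal{A}}[\tau](\mathcal{U})$ is this $z$. Attraction set: for a nonempty family $\mathcal{E}$ of subsets of $E$, $(\mathbf{as})[E;\mathbf{H};\tau;\mathbf{h};\mathcal{E}]$ is the set of all $y\in\mathbf{H}$ for which there is a net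 $g:D\to E$ (with $(D,\preceq)$ a nonempty directed set) such that for every $S\in\mathcal{E}$ the net $g$ is eventually in $S$, and the net $\mathbf{h}\circ g$ converges to $y$ in $(\mathbf{H},\tau)$. *)

(* Defs.v *)
From HB Require Import structures.
From mathcomp Require Import all_boot all_order.
From mathcomp Require Import boolp classical_sets functions filter.
From mathcomp Require Import topology_structure separation_axioms compact.
From mathcomp Require Import measurable_structure.

Set Implicit Arguments.
Unset Strict Implicit.
Unset Printing Implicit Defensive.

Local Open Scope classical_set_scope.

Definition set_algebra (E : Type) (A : set (set E)) : Prop :=
  [/\ A setT, setC_closed A & setI_closed A].

Definition alg_filter (E : Type) (A F : set (set E)) : Prop :=
  [/\ F `<=` A, F !=set0, ~ F set0, setI_closed F
    & forall P L, F P -> A L -> P `<=` L -> F L].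

Definition alg_ultrafilter (E : Type) (A : set (set E)) : set (set (set E)) :=
  [set U | alg_filter A U /\
           forall F, alg_filter A F -> U `<=` F -> F = U].

Definition alg_ultrafilter_above (E : Type) (A Es : set (set E)) :
    set (set (set E)) :=
  [set U | alg_ultrafilter A U /\ Es `<=` U].

Definition local_base (H : topologicalType) (z : H) (Z : set (set H)) : Prop :=
  Z `<=` nbhs z /\ forall S, nbhs z S -> exists2 B, Z B & B `<=` S.

Definition filter_base_cvg (H : topologicalType) (B : set (set H)) (z : H) :
    Prop :=
  forall S, nbhs z S -> exists2 B0, B B0 & B0 `<=` S.

Definition image_family (E H : Type) (h : E -> H) (F : set (set E)) :
    set (set H) :=
  [set h @` P | P in F].

(* [xget] returns the default, an arbitrary point of the nonempty space [H],
   only if no limit exists; by [ultrafilter_limitP] below this never happens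
   for the ultrafilters of an algebra [A] such as in the theorem, and the limit
   is then unique. The algebra only enters through the domain of the map. *)
Definition ultrafilter_limit (E : Type) (H : topologicalType)
    (H0 : [set: H] !=set0) (h : E -> H) (U : set (set E)) : H :=
  xget (projT1 (cid H0)) [set z | filter_base_cvg (image_family h U) z].

(* Directed sets are preordered, not necessarily antisymmetric. *)
Definition directed (D : Type) (le : D -> D -> Prop) : Prop :=
  [/\ [set: D] !=set0,
      forall d, le d d,
      forall d1 d2 d3, le d1 d2 -> le d2 d3 -> le d1 d3
    & forall d1 d2, exists d3, le d1 d3 /\ le d2 d3].

Definition net_eventually (D : Type) (le : D -> D -> Prop) (X : Type)
    (g : D -> X) (S : set X) : Prop :=
  exists d, forall d', le d d' -> S (g d').

Definition net_cvg (D : Type) (le : D -> D -> Prop) (H : topologicalType)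
    (g : D -> H) (y : H) : Prop :=
  forall S, nbhs y S -> net_eventually le g S.

Definition attraction_set (E : Type) (H : topologicalType) (h : E -> H)
    (Es : set (set E)) : set H :=
  [set y | exists (D : Type) (le : D -> D -> Prop) (g : D -> E),
     [/\ directed le, forall S, Es S -> net_eventually le g S
       & net_cvg le (h \o g) y]].

Lemma ultrafilter_limitP (E : Type) (H : topologicalType)
    (H0 : [set: H] !=set0) (cptH : compact [set: H]) (hausH : hausdorff_space H)
    (h : E -> H) (A : set (set E)) (algA : set_algebra A)
    (baseA : forall z : H, exists2 Z, local_base z Z &
               forall B, Z B -> A (h @^-1` B))
    (U : set (set E)) (ultU : alg_ultrafilter A U) (z : H) :
  filter_base_cvg (image_family h U) z <-> ultrafilter_limit H0 h U = z.
Proof.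
have [[UA [P0 UP0] U0 UI Uup] Umax] := ultU.
have uniq z1 z2 : filter_base_cvg (image_family h U) z1 ->
    filter_base_cvg (image_family h U) z2 -> z1 = z2.
  move=> c1 c2; apply: hausH => S1 S2 n1 n2.
  have [_ [B1 UB1 <-] s1] := c1 _ n1; have [_ [B2 UB2 <-] s2] := c2 _ n2.
  have [x [x1 x2]] : B1 `&` B2 !=set0.
    by apply/set0P/eqP => e; apply: U0; rewrite -e; apply: UI.
  by exists (h x); split; [apply: s1; exists x|apply: s2; exists x].
suff [z0 cz0] : exists z0, filter_base_cvg (image_family h U) z0.
  have lim : filter_base_cvg (image_family h U) (ultrafilter_limit H0 h U).
    exact: (@xgetPex H _ [set z | filter_base_cvg (image_family h U) z]
             (ex_intro _ z0 cz0)).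
  by split => [cz|<-//]; exact: uniq lim cz.
pose F := filter_from U (fun P => h @` P).
have PF : ProperFilter F.
  apply: filter_from_proper; last first.
    move=> P UP; apply/image_nonempty/set0P/eqP => e.
    by apply: U0; rewrite -e.
  apply: filter_from_filter; first by exists P0.
  move=> P Q UP UQ; exists (P `&` Q); first exact: UI.
  by move=> _ [x [Px Qx] <-]; split; exists x.
have [z0 [_ cz0]] := cptH F PF filterT.
exists z0 => S nS.
have [Z [Zn Zb] ZA] := baseA z0; have [B ZB BS] := Zb _ nS.
exists (h @` (h @^-1` B)); last by move=> _ [x Bx <-]; exact: BS.
exists (h @^-1` B) => //.
pose G : set (set E) :=
  [set L | A L /\ exists2 C, U C & C `&` h @^-1` B `<=` L].
suff -> : U = G.
  by split; [exact: ZA|exists P0 => // x []].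
have [_ _ AI] := algA.
apply/esym/Umax; last by move=> C UC; split; [exact: UA|exists C => // x []].
split.
- by move=> L [].
- by exists P0; split; [exact: UA|exists P0 => // x []].
- move=> [_ [C UC CB]].
  have FC : F (h @` C) by exists C.
  have [_ [[x Cx <-] Bx]] := cz0 _ _ FC (Zn _ ZB).
  by case: (CB x).
- move=> L1 L2 [A1 [C1 U1 s1]] [A2 [C2 U2 s2]]; split; first exact: AI.
  exists (C1 `&` C2); first exact: UI.
  by move=> x [[c1 c2] b]; split; [apply: s1|apply: s2].
- move=> P L [AP [C UC s]] AL PL; split=> //.
  by exists C => // x /s /PL.
Qed.

(* Main.v *)
Require Import Defs.
From HB Require Import structures.
From mathcomp Require Import all_boot all_order.
From mathcomp Require Import boolp classical_sets functions filter.
From mathcomp Require Import topology_structure separation_axioms compact.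
From mathcomp Require Import measurable_structure.

Set Implicit Arguments.
Unset Strict Implicit.
Unset Printing Implicit Defensive.

Local Open Scope classical_set_scope.

(** Nets and filters carry the same convergence information, and both
    inclusions translate between them.

    Given a net in [E] along which [h] tends to [y], the sets in which the net
    is eventually form a proper filter on [E]; extend it to an ultrafilter [V]
    on [E]. The trace of [V] on the algebra is an ultrafilter of the algebra
    ([ultra_trace]). It contains every member of [Es], and also every
    [h @^-1` B] with [B] in the local base at [y], because the net is
    eventually in each of these sets: hence its image under [h] converges to
    [y] ([trace_cvg]), and by uniqueness of limits [y] is the limit attached
    to the trace.

    Conversely an ultrafilter [U] of the algebra containing [Es] is followed by
    the net of its pointed members ([pointed_directed],
    [pointed_eventually]), which is eventually in each member of [U]; so it is
    eventually in each member of [Es], and its image under [h] converges to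
    wherever the image of [U] does. *)

Lemma net_eventually_proper (D E : Type) (le : D -> D -> Prop) (g : D -> E) :
  directed le -> ProperFilter [set S | net_eventually le g S].
Proof.
move=> [[d0 _] refl trans dir]; split.
  by move=> [d] /(_ d (refl d)).
split.
- by exists d0.
- move=> P Q [d1 P1] [d2 Q2]; have [d3 [l13 l23]] := dir d1 d2.
  by exists d3 => d l3d; split; [exact/P1/(trans _ d3)|exact/Q2/(trans _ d3)].
- by move=> P Q PQ [d Pd]; exists d => d' /Pd /PQ.
Qed.

(** Closure under complements is what makes the trace maximal: a set of [A]
    outside the ultrafilter has its complement in the trace, so no filter of
    [A] extending the trace can contain that set. *)
Lemma ultra_trace (E : Type) (A V : set (set E)) :
  set_algebra A -> UltraFilter V -> alg_ultrafilter A (A `&` V).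
Proof.
move=> [AT AC AI] UV; split.
  split.
  - exact: subIsetl.
  - by exists setT; split=> //; exact: filterT.
  - by move=> [_]; exact: filter_not_empty.
  - by move=> P Q [AP VP] [AQ VQ]; split; [exact: AI|exact: filterI].
  - by move=> P L [AP VP] AL PL; split=> //; exact: filterS VP.
move=> F [FA _ F0 FI _] VF; apply/seteqP; split=> // P FP.
split; first exact: FA.
have [//|VCP] := in_ultra_setVsetC P UV.
exfalso; apply: F0; rewrite -(setICr P); apply: FI => //.
by apply: VF; split=> //; apply: AC; exact: FA.
Qed.

(** The local base supplies, inside each neighborhood of [y], one whose
    preimage survives the passage from [V] to its trace. *)
Lemma trace_cvg (E : Type) (H : topologicalType) (h : E -> H)
    (A V : set (set E)) (Z : set (set H)) (y : H) :
  local_base y Z -> (forall B, Z B -> A (h @^-1` B)) ->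
  (forall S, nbhs y S -> V (h @^-1` S)) ->
  filter_base_cvg (image_family h (A `&` V)) y.
Proof.
move=> [Zy Zbase] ZA Vy S /Zbase[B ZB BS].
exists (h @` (h @^-1` B)); last by move=> _ [x Bx <-]; exact: BS.
exists (h @^-1` B) => //.
by split; [exact: ZA|exact/Vy/Zy].
Qed.

Definition pointed_member (E : Type) (U : set (set E)) : Type :=
  {p : set E * E | U p.1 /\ p.1 p.2}.

(** Only the sets are compared: the point of a member is free, so the net
    visits all points of each member. *)
Definition pointed_le (E : Type) (U : set (set E)) (p q : pointed_member U) :=
  (sval q).1 `<=` (sval p).1.

Definition pointed_net (E : Type) (U : set (set E)) (p : pointed_member U) :
  E := (sval p).2.

Lemma pointed_memberE (E : Type) (A U : set (set E)) (P : set E) :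
  alg_filter A U -> U P -> exists p : pointed_member U, (sval p).1 = P.
Proof.
move=> [_ _ U0 _ _] UP.
have [x Px] : P !=set0 by apply/set0P/eqP => P0; apply: U0; rewrite -P0.
by exists (exist _ (P, x) (conj UP Px)).
Qed.

Lemma pointed_directed (E : Type) (A U : set (set E)) :
  alg_filter A U -> directed (@pointed_le E U).
Proof.
move=> FU; have [_ [P UP] _ UI _] := FU; split.
- by have [p _] := pointed_memberE FU UP; exists p.
- by move=> p.
- by move=> p q r pq qr; exact: subset_trans qr pq.
- move=> p q.
  have [r rE] := pointed_memberE FU (UI _ _ (svalP p).1 (svalP q).1).
  by exists r; rewrite /pointed_le rE; split=> x [].
Qed.

Lemma pointed_eventually (E : Type) (A U : set (set E)) (P : set E) :
  alg_filter A U -> U P ->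
  net_eventually (@pointed_le E U) (@pointed_net E U) P.
Proof.
move=> FU /(pointed_memberE FU)[p <-].
by exists p => q; apply; exact: (svalP q).2.
Qed.

Theorem theorem13p1 (E : Type) (E0 : [set: E] !=set0)
    (H : topologicalType) (H0 : [set: H] !=set0)
    (cptH : compact [set: H]) (hausH : hausdorff_space H)
    (h : E -> H) (A : set (set E)) (algA : set_algebra A)
    (baseA : forall z : H, exists2 Z : set (set H), local_base z Z &
               forall B, Z B -> A (h @^-1` B)) :
  forall Es : set (set E), Es !=set0 -> Es `<=` A ->
    attraction_set h Es
    = [set ultrafilter_limit H0 h U | U in alg_ultrafilter_above A Es].
Proof.
move=> Es _ EsA.
have limP := ultrafilter_limitP H0 cptH hausH algA baseA.
apply/seteqP; split=> [y [D [le [g [dir gEs gy]]]]|_ [U [ultU EsU] <-]].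
  have [V [UV gV]] := ultraFilterLemma (net_eventually_proper g dir).
  exists (A `&` V); first split; first exact: ultra_trace.
    by move=> S EsS; split; [exact: EsA|exact/gV/gEs].
  apply/limP; first exact: ultra_trace.
  by have [Z Zy ZA] := baseA y; apply: trace_cvg Zy ZA _ => S /gy gS; exact: gV.
have FU := ultU.1; have lim_cvg := (limP U ultU _).2 erefl.
exists (pointed_member U), (@pointed_le E U), (@pointed_net E U); split.
- exact: pointed_directed FU.
- by move=> S /EsU; exact: pointed_eventually FU.
- move=> S /lim_cvg[_ [P UP <-] PS].
  have [p pP] := pointed_eventually FU UP.
  by exists p => q /pP Pq; apply: PS; exists (pointed_net q).
Qed.
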